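(* Let $k \geq 2$ be an integer and let $n_1, \dots, n_k \in \mathbb{N}$. For each $i \in [k]$, let $r_i \in [n_i]$ and $\mathcal{A}_i \subseteq {[n_i] \choose \leq r_i}$. If $\mathcal{A}_1, \dots, \mathcal{A}_k$ are cross-intersecting, then \[\prod_{i=1}^k |\mathcal{A}_i| \leq \prod_{i=1}^k \left( \sum_{j = 1}^{r_i} {n_i-1 \choose j-1} \right),\] and equality holds if $\mathcal{A}_i = \{A \in {[n_i] \choose \leq r_i} \colon 1 \in A\}$ for each $i \in [k]$.
   Context: $\mathbb{N} = \{1,2,\dots\}$ is the set of positive integers and $[n] = \{1,\dots,n\}$. For a set $X$ and an integer $r \geq 0$, ${X \choose \leq r} = \{A \subseteq X \colon |A| \leq r\}$ is the family of all subsets of $X$ of size at most $r$. A family is a set of sets; families may be empty and need not be distinct from one another. Families $\mathcal{A}_1, \dots, \mathcal{A}_k$ are cross-intersecting if for every $i, j \in [k]$ with $i \neq j$, we have $A \cap B \neq \emptyset$ for every $A \in \mathcal{A}_i$ and every $B \in \mathcal{A}_j$. *)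

(* Defs.v *)
From mathcomp Require Import all_boot finmap.

Local Open Scope fset_scope.

(* [n] = {1, ..., n}, as a finite set of natural numbers, so that sets taken
   from [n_i] and [n_j] with n_i != n_j can be intersected. *)
Definition segment (n : nat) : {fset nat} := [fset j in iota 1 n].

Definition subsets_le (X : {fset nat}) (r : nat) : {fset {fset nat}} :=
  [fset A in fpowerset X | #|` A| <= r].

Definition cross_intersecting (k : nat) (F : 'I_k -> {fset {fset nat}}) : Prop :=
  forall i j : 'I_k, i != j ->
  forall A B : {fset nat}, A \in F i -> B \in F j -> A `&` B != fset0.

Definition star (n r : nat) : {fset {fset nat}} :=
  [fset A in subsets_le (segment n) r | 1 \in A].

Lemma in_segment (n j : nat) : (j \in segment n) = (1 <= j <= n).
Proof. by rewrite !inE mem_iota add1n ltnS. Qed.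

Lemma in_subsets_le (X : {fset nat}) (r : nat) (A : {fset nat}) :
  (A \in subsets_le X r) = (A `<=` X) && (#|` A| <= r).
Proof. by rewrite !inE fpowersetE. Qed.

Lemma in_star (n r : nat) (A : {fset nat}) :
  (A \in star n r) = (A \in subsets_le (segment n) r) && (1 \in A).
Proof. by rewrite !inE. Qed.

Lemma star_cross_intersecting (k : nat) (n r : 'I_k -> nat) :
  cross_intersecting k (fun i => star (n i) (r i)).
Proof.
move=> i j _ A B; rewrite !in_star => /andP[_ A1] /andP[_ B1].
by apply/fset0Pn; exists 1; rewrite inE A1 B1.
Qed.

(* Main.v *)
Require Import Defs.
From mathcomp Require Import all_boot finmap zify.

(** Only pairs matter: if [a i * a j <= b i * b j] for all [i != j], then at
    most one [i] has [a i > b i], and pairing that [i] with any other index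
    bounds the whole product ([prod_le_of_pairs]).  So let [F] and [G] be
    crossing families of subsets of [X] and [Y], of sizes at most [r] and [s],
    with [X] contained in [Y]; the bound [card_mul_crossing_le] on
    [#|F| * #|G|] goes by induction on the size of [Y].  Families
    are split at an element into their link and their deletion.

    If some [y] of [Y] is not in [X], both [link y G] and [deletion y G] cross
    [F], and Pascal's rule for [star_size] adds up the two inductive bounds.

    If [X = Y], pick [x] in [X] and split both families at [x].  When the two
    families obtained from [F] cross the two obtained from [G], the four
    inductive bounds multiply out to the claim.  The obstruction is a pair
    [A \in F], [B \in G] with [A `&` B = [fset x]].  Shifting [x] towards the
    other elements preserves all hypotheses and the sizes, and at the end every
    such pair covers [X] ([exists_tight]).  Hence the obstructing pairs form a
    matching: the partner of [A \in link x F] is its complement in [X `\ x].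
    Each matched pair can be destroyed either by discarding the member of [G]
    and adding to [F] its member deprived of [x], or the other way round
    ([swap_matched]).  Treating half of the pairs each way
    leaves [#|F|] and [#|G|] unchanged, which settles an even number of pairs.

    For an odd number of pairs the two roundings change the sizes by [+1, -1]
    and [-1, +1].  Their eight inductive bounds still give the claim
    ([rounded_products]): failure forces equality everywhere, hence equality of
    the bounds for the link and for the deletion, which only happens when
    [r] and [s] are saturated; then a square would be a product of two
    consecutive positive integers. *)

Local Open Scope fset_scope.
Local Open Scope nat_scope.

(** * The size of a star *)

Definition star_size (n r : nat) : nat := \sum_(j < r) 'C(n.-1, j).

Lemma star_sizeE (n r : nat) :
  \sum_(1 <= j < r.+1) 'C(n - 1, j - 1) = star_size n r.
Proof.
rewrite big_add1 /= big_mkord subn1.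
by apply: eq_bigr => j _; rewrite subn1.
Qed.

Lemma star_size1 (r : nat) : star_size 1 r.+1 = 1.
Proof. by rewrite /star_size big_ord_recl /= big1. Qed.

Lemma star_size_gt0 (n r : nat) : 0 < star_size n r.+1.
Proof. by rewrite /star_size big_ord_recl bin0. Qed.

Lemma star_size_pascal (n r : nat) :
  star_size n.+2 r.+1 = star_size n.+1 r + star_size n.+1 r.+1.
Proof.
rewrite /star_size /= big_ord_recl [X in _ = _ + X]big_ord_recl !bin0 addnCA.
congr (_ + _); rewrite -big_split; apply: eq_bigr => j _.
by rewrite lift0 binS addnC.
Qed.

Lemma star_size_saturated (n r s : nat) : 0 < n -> n <= r -> n <= s ->
  star_size n r = star_size n s.
Proof.
move=> n0 nr ns.
have sat t : n <= t -> star_size n t = star_size n n.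
  move=> /subnKC <-; rewrite /star_size big_split_ord /= [X in _ + X]big1 ?addn0 //.
  by move=> j _; apply: bin_small; lia.
by rewrite !sat.
Qed.

(** The difference of the two sides is ['C(n, r)], so equality means that every
    binomial coefficient of the row is already counted. *)
Lemma star_size_stalled (n r : nat) :
  star_size n.+1 r = star_size n.+1 r.+1 -> n < r.
Proof.
rewrite /star_size big_ord_recr /=.
by case: (ltnP n r) => // rn; have := rn; rewrite -bin_gt0; lia.
Qed.

(** * Links and deletions *)

Definition deletion (x : nat) (F : {fset {fset nat}}) : {fset {fset nat}} :=
  [fset A in F | x \notin A].

Definition link (x : nat) (F : {fset {fset nat}}) : {fset {fset nat}} :=
  [fset A `\ x | A in F `\` deletion x F].

Lemma in_deletion x F A : (A \in deletion x F) = (A \in F) && (x \notin A).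
Proof. by rewrite !inE. Qed.

Lemma in_link x F A : (A \in link x F) = (x \notin A) && (x |` A \in F).
Proof.
apply/imfsetP/andP => /= [[C]|[xA AF]].
  rewrite in_fsetD in_deletion => /andP[nC CF] ->.
  have xC : x \in C by move: nC; rewrite CF negbK.
  by rewrite fsetD1K // !inE eqxx.
by exists (x |` A); rewrite ?fsetU1K // in_fsetD in_deletion AF fset1U1.
Qed.

Lemma card_link_deletion x F : #|` F| = #|` link x F| + #|` deletion x F|.
Proof.
rewrite card_in_imfset /=; last first.
  move=> A B; rewrite !in_fsetD !in_deletion.
  case: (A \in F) => //; case: (B \in F) => //; rewrite ?andbF ?andbT //=.
  rewrite !negbK => xA xB eqAB.
  by rewrite -(fsetD1K xA) eqAB fsetD1K.
rewrite -(cardfsID (deletion x F) F) addnC; congr (_ + #|` _|).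
by apply/fsetP=> A; rewrite in_fsetI !in_deletion andbA andbb.
Qed.

Lemma link_subsets_le x X r F :
  F `<=` subsets_le X r.+1 -> link x F `<=` subsets_le (X `\ x) r.
Proof.
move=> FX; apply/fsubsetP => A; rewrite in_link => /andP[xA /(fsubsetP FX)].
rewrite !in_subsets_le cardfsU1 xA add1n ltnS => /andP[AX ->]; rewrite andbT.
by rewrite fsubsetD1 xA andbT (fsubset_trans _ AX) // fsubsetU1.
Qed.

Lemma deletion_subsets_le x X r F :
  F `<=` subsets_le X r -> deletion x F `<=` subsets_le (X `\ x) r.
Proof.
move=> FX; apply/fsubsetP => A; rewrite in_deletion => /andP[/(fsubsetP FX)].
by rewrite !in_subsets_le fsubsetD1 => /andP[-> ->] ->.
Qed.

Lemma subsets_leS X r s : r <= s -> subsets_le X r `<=` subsets_le X s.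
Proof.
move=> rs; apply/fsubsetP => A; rewrite !in_subsets_le => /andP[-> Ar] /=.
exact: leq_trans rs.
Qed.

(** Splitting at a second element [y != x] turns this count into Pascal's rule
    for [star_size]. *)
Lemma card_subsets_le_containing (X : {fset nat}) (x r : nat) : x \in X ->
  #|` [fset A in subsets_le X r | x \in A]| = star_size #|` X| r.
Proof.
set St := fun X r => [fset A in subsets_le X r | x \in A].
have inSt Y t A : (A \in St Y t) = [&& A `<=` Y, #|` A| <= t & x \in A].
  by rewrite /St !inE fpowersetE andbA.
have St0 Y : #|` St Y 0| = 0.
  apply/eqP; rewrite cardfs_eq0; apply/eqP/fsetP => A; rewrite inSt in_fset0 leqn0 cardfs_eq0.
  by case: eqP => [->|]; rewrite ?in_fset0 !andbF.
move: {2}#|` X| (erefl #|` X|) => n; elim: n X r => [|n IHn] X r cardX xX.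
  by move: xX; rewrite (cardfs0_eq cardX).
case: r => [|r]; first by rewrite St0 /star_size big_ord0.
rewrite -/(St _ _) cardX; have := cardfsD1 x X; rewrite xX cardX add1n => -[cardX1].
case: n => [|n] in IHn cardX cardX1 *.
  have XE : X = [fset x] by rewrite -(fsetD1K xX) (cardfs0_eq (esym cardX1)) fsetU0.
  rewrite star_size1; apply/eqP/cardfs1P; exists [fset x]; apply/fsetP => A.
  rewrite inSt XE inE fsubset1; case: eqP => [->|_]; rewrite ?cardfs1 ?inE ?eqxx //.
  by case: eqP => [->|]; rewrite ?in_fset0 ?andbF.
have /fset0Pn[y] : X `\ x != fset0 by rewrite -cardfs_gt0 -cardX1.
rewrite !inE => /andP[yx yX].
have cardXy : #|` X `\ y| = n.+1.
  by have := cardfsD1 y X; rewrite yX cardX add1n => -[].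
have xXy : x \in X `\ y by rewrite !inE eq_sym yx.
rewrite (card_link_deletion y) star_size_pascal -cardXy -!IHn //.
congr (_ + _); congr #|` _|; apply/fsetP => A.
  rewrite in_link !inSt fsubUset fsub1set yX fsubsetD1 cardfsU1 !inE eq_sym (negPf yx) /=.
  by case: (boolP (y \in A)) => yA; rewrite ?andbF ?andbT //= add1n ltnS.
rewrite in_deletion !inSt fsubsetD1.
by case: (y \in A); rewrite ?andbF ?andbT.
Qed.

Lemma in_segment1 n : 1 <= n -> 1 \in segment n.
Proof. by rewrite in_segment. Qed.

Lemma card_segment n : #|` segment n| = n.
Proof. by rewrite card_fseq undup_id ?iota_uniq ?size_iota. Qed.

Lemma card_star n r : 1 <= n -> #|` star n r| = star_size n r.
Proof. by move=> n1; rewrite card_subsets_le_containing ?card_segment ?in_segment1. Qed.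

(** * Crossing pairs of families *)

Definition crossing (F G : {fset {fset nat}}) : Prop :=
  forall A B, A \in F -> B \in G -> A `&` B != fset0.

Lemma crossing_sym F G : crossing F G -> crossing G F.
Proof. by move=> FG A B AG BF; rewrite fsetIC FG. Qed.

Lemma crossing_subsets_le0 F G X : G `<=` subsets_le X 0 -> crossing F G ->
  #|` F| * #|` G| = 0.
Proof.
move=> G0 FG; have [->|/fset0Pn[B BG]] := eqVneq G fset0.
  by rewrite cardfs0 muln0.
have [->|/fset0Pn[A AF]] := eqVneq F fset0; first by rewrite cardfs0.
have := fsubsetP G0 _ BG; rewrite in_subsets_le leqn0 cardfs_eq0.
by case/andP=> _ /eqP B0; have := FG _ _ AF BG; rewrite B0 fsetI0 eqxx.
Qed.

Lemma crossing_link y X r F G : y \notin X -> F `<=` subsets_le X r ->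
  crossing F G -> crossing F (link y G).
Proof.
move=> yX FX FG A B AF; rewrite in_link => /andP[_ /(FG _ _ AF)/fset0Pn[z]].
rewrite in_fsetI in_fset1U => /andP[zA /orP[/eqP zy|zB]]; last first.
  by apply/fset0Pn; exists z; rewrite in_fsetI zA.
have := fsubsetP FX _ AF; rewrite in_subsets_le => /andP[/fsubsetP/(_ z zA)].
by rewrite zy (negPf yX).
Qed.

Lemma card_mul_crossing_singleton X r s F G : #|` X| = 1 ->
  F `<=` subsets_le X r -> G `<=` subsets_le X s -> crossing F G ->
  #|` F| * #|` G| <= 1.
Proof.
move=> cardX FX GX FG.
(* the empty set meets nothing, so only [X] itself can be a member *)
have le1 H K t : H `<=` subsets_le X t -> crossing H K -> K != fset0 ->
    #|` H| <= 1.
  move=> HX HK /fset0Pn[B BK]; rewrite -(cardfs1 (X : {fset nat})); apply: fsubset_leq_card.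
  apply/fsubsetP => A AH; rewrite inE.
  have /fset0Pn[z] := HK _ _ AH BK; rewrite in_fsetI => /andP[zA _].
  have := fsubsetP HX _ AH; rewrite in_subsets_le => /andP[AX _].
  by rewrite eqEfcard AX cardX cardfs_gt0; apply/fset0Pn; exists z.
have [->|F0] := eqVneq F fset0; first by rewrite cardfs0.
have [->|G0] := eqVneq G fset0; first by rewrite cardfs0 muln0.
exact: leq_mul (le1 _ _ _ FX FG G0) (le1 _ _ _ GX (crossing_sym _ _ FG) F0).
Qed.

(** * Shifting *)

Definition shiftable x i (F : {fset {fset nat}}) (A : {fset nat}) : bool :=
  [&& x \in A, i \notin A & i |` (A `\ x) \notin F].

Definition shift x i (F : {fset {fset nat}}) : {fset {fset nat}} :=
  [fset (if shiftable x i F A then i |` (A `\ x) else A) | A in F].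

Lemma shiftP x i F A : A \in shift x i F ->
  (A \in F /\ ~~ shiftable x i F A) \/
  (exists C, [/\ C \in F, shiftable x i F C & A = i |` (C `\ x)]).
Proof.
case/imfsetP => /= C CF ->; case: ifP => Csh; first by right; exists C.
by left; rewrite Csh.
Qed.

Lemma card_shift x i F : #|` shift x i F| = #|` F|.
Proof.
apply: card_in_imfset => A B /= AF BF.
case: ifP => shA; case: ifP => shB.
- case/and3P: shA => xA iA _; case/and3P: shB => xB iB _ eqAB.
  rewrite -(fsetD1K xA) -(fsetD1K xB); congr (_ |` _).
  by rewrite -(@fsetU1K _ i (A `\ x)) ?eqAB ?fsetU1K // !inE negb_and ?iA ?iB orbT.
- by case/and3P: shA => _ _ nF eqAB; rewrite eqAB BF in nF.
- by case/and3P: shB => _ _ nF eqAB; rewrite -eqAB AF in nF.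
- by [].
Qed.

Lemma shift_subsets_le x i X r F : i \in X ->
  F `<=` subsets_le X r -> shift x i F `<=` subsets_le X r.
Proof.
move=> iX FX; apply/fsubsetP => A /shiftP[[/(fsubsetP FX)//]|].
case=> C [/(fsubsetP FX) + /and3P[xC iC _] ->].
rewrite !in_subsets_le fsubUset fsub1set iX (cardfsD1 x C) xC => /andP[CX Cr].
rewrite (fsubset_trans (fsubsetDl _ _) CX) /=.
by rewrite cardfsU1 !inE negb_and iC orbT.
Qed.

(** If the moved set missed [B], then [C] and [B] would meet in [x] alone; as
    [B] did not move although [i \notin B], the set [i |` (B `\ x)] is in [G],
    and it misses [C]. *)
Lemma shifted_meets_fixed x i F G C B :
  crossing F G -> C \in F -> shiftable x i F C ->
  B \in G -> ~~ shiftable x i G B -> (i |` (C `\ x)) `&` B != fset0.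
Proof.
move=> FG CF /and3P[xC iC _] BG nB.
have [disj|//] := eqVneq ((i |` (C `\ x)) `&` B) fset0.
have nmem z : z \in i |` (C `\ x) -> z \notin B.
  by move=> zC; apply/negP => zB; have := in_fset0 z; rewrite -disj in_fsetI zC zB.
have iB : i \notin B by apply: nmem; rewrite fset1U1.
have CB z : z \in C -> z \in B -> z = x.
  move=> zC zB; apply/eqP; apply: contraTT zB => zx.
  by apply: nmem; rewrite !inE zx zC orbT.
have xB : x \in B.
  have /fset0Pn[z] := FG _ _ CF BG; rewrite in_fsetI => /andP[zC zB].
  by rewrite -(CB z zC zB).
have : i |` (B `\ x) \in G by move: nB; rewrite /shiftable xB iB /= negbK.
move=> /(FG _ _ CF) /fset0Pn[z]; rewrite !inE => /andP[zC].
case/orP => [/eqP zi|/andP[/eqP zx zB]]; first by rewrite -zi zC in iC.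
by case: zx; apply: CB.
Qed.

Lemma crossing_shift x i F G :
  crossing F G -> crossing (shift x i F) (shift x i G).
Proof.
move=> FG A B /shiftP[[AF nA]|[C [CF shC ->]]] /shiftP[[BG nB]|[D [DG shD ->]]].
- exact: FG.
- by rewrite fsetIC; apply: (@shifted_meets_fixed x i G F) => //; apply: crossing_sym.
- exact: (@shifted_meets_fixed x i F G).
- by apply/fset0Pn; exists i; rewrite in_fsetI !fset1U1.
Qed.

(** A shift creates no member containing [x] and destroys at least one if it
    does anything, so that repeated shifting terminates. *)
Lemma card_link_shift x i F A : x != i -> A \in F -> shiftable x i F A ->
  #|` link x (shift x i F)| < #|` link x F|.
Proof.
move=> xi AF shA; apply: fproper_ltn_card; rewrite fproperE.
have stay C : x \in C -> C \in shift x i F -> C \in F /\ ~~ shiftable x i F C.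
  move=> xC /shiftP[//|[D [_ _ CE]]]; move: xC.
  by rewrite CE !inE eqxx (negPf xi).
apply/andP; split.
  apply/fsubsetP => C; rewrite !in_link => /andP[xC CS]; rewrite xC.
  by have [] := stay _ (fset1U1 _ _) CS.
have xA : x \in A by case/and3P: shA.
apply/fsubsetPn; exists (A `\ x); rewrite in_link fsetD1K ?fsetD11 ?AF //=.
by apply/negP => /(stay _ xA)[_]; rewrite shA.
Qed.

(** The property of families stable under shifting that the rest of the
    argument needs: an intersection reduced to [x] leaves no room in [X] to move
    [x] out of the way. *)
Definition tight x X (F G : {fset {fset nat}}) : Prop :=
  forall A B, A \in F -> B \in G -> A `&` B = [fset x] -> X `<=` A `|` B.

Lemma exists_tight (x r s : nat) X F G :
  F `<=` subsets_le X r -> G `<=` subsets_le X s -> crossing F G ->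
  exists F' G', [/\ F' `<=` subsets_le X r, G' `<=` subsets_le X s,
    crossing F' G', tight x X F' G' & #|` F'| = #|` F| /\ #|` G'| = #|` G|].
Proof.
move: {2}#|` link x F| (leqnn #|` link x F|) => n.
elim/ltn_ind: n F G => n IHn F G Fn FX GX FG.
have [/existsP/= [[i iX]] /existsP/= [[A AF]] /= /andP[xi shA]|] :=
  boolP [exists i : X, exists A : F, (x != val i) && shiftable x (val i) F (val A)].
  have lt := card_link_shift _ _ _ _ xi AF shA.
  have [|||F' [G' [F'X G'X F'G' T [cF cG]]]] :=
    IHn _ (leq_trans lt Fn) (shift x i F) (shift x i G) (leqnn _).
  - exact: shift_subsets_le.
  - exact: shift_subsets_le.
  - exact: crossing_shift.
  by exists F', G'; split=> //; rewrite cF cG !card_shift.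
move=> nsh; exists F, G; split=> // A B AF BG AB.
apply/fsubsetP => i iX; rewrite in_fsetU; apply: contraNT nsh.
rewrite negb_or => /andP[iA iB].
have : x \in A `&` B by rewrite AB inE.
rewrite in_fsetI => /andP[xA xB].
apply/existsP; exists [` iX]; apply/existsP; exists [` AF] => /=.
rewrite /shiftable xA iA andTb; apply/andP; split; first by apply: contraNneq iA => <-.
apply/negP => /FG/(_ BG)/fset0Pn[z]; rewrite !inE => /andP[/orP[/eqP->|]].
  by rewrite (negPf iB).
case/andP=> zx zA zB; have : z \in A `&` B by rewrite in_fsetI zA.
by rewrite AB inE (negPf zx).
Qed.

(** * The matching of obstructing pairs *)

Definition trace x F : {fset {fset nat}} := link x F `|` deletion x F.

(** The members of the link of [F] whose complement in [X `\ x] is in the link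
    of [G]; for tight crossing families these are all the members of the trace
    of [F] that miss a member of the trace of [G] ([tight_disjoint_traces]). *)
Definition matched x X (F G : {fset {fset nat}}) : {fset {fset nat}} :=
  [fset A in link x F | (X `\ x) `\` A \in link x G].

Lemma in_matched x X F G A :
  (A \in matched x X F G) = (A \in link x F) && ((X `\ x) `\` A \in link x G).
Proof. by rewrite !inE. Qed.

(** A set of the trace comes from a member of [F] by possibly removing [x]; that
    member can only contain [x] if the set is in the link. *)
Lemma trace_lift x F A : A \in trace x F ->
  x \notin A /\ exists A1, [/\ A1 \in F, A1 `<=` x |` A & x \in A1 -> A \in link x F].
Proof.
rewrite in_fsetU in_link in_deletion => /orP[/andP[xA AF]|/andP[AF xA]].
  by split=> //; exists (x |` A); split; rewrite // xA.
by split=> //; exists A; split; rewrite ?fsubsetU1 // (negPf xA).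
Qed.

(** Disjoint traces lift to members that meet, hence in [x] alone; tightness
    makes these members cover [X], so the traces are complementary. *)
Lemma tight_disjoint_traces x X s F G A B :
  G `<=` subsets_le X s -> crossing F G -> tight x X F G ->
  A \in trace x F -> B \in trace x G -> A `&` B = fset0 ->
  A \in matched x X F G /\ B = (X `\ x) `\` A.
Proof.
move=> GX FG T AF BG AB0.
have [xA [A1 [A1F A1A lA]]] := trace_lift _ _ _ AF.
have [xB [B1 [B1G B1B lB]]] := trace_lift _ _ _ BG.
have AB y : y \in A -> y \in B -> False.
  by move=> yA yB; have := in_fset0 y; rewrite -AB0 in_fsetI yA yB.
have sub y : y \in A1 `&` B1 -> y = x.
  rewrite in_fsetI => /andP[/(fsubsetP A1A) + /(fsubsetP B1B)].
  by rewrite !inE; case: eqP => //= _ yA /(AB _ yA).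
have /fset0Pn[y yAB] := FG _ _ A1F B1G.
move: (yAB); rewrite (sub y yAB) in_fsetI => /andP[xA1 xB1].
have XAB : X `<=` A1 `|` B1.
  apply: T => //; apply/fsetP => t; rewrite in_fset1.
  by apply/idP/eqP => [/sub//|->]; rewrite in_fsetI xA1.
have BX : B `<=` X.
  have := fsubsetP GX _ B1G; rewrite in_subsets_le => /andP[B1X _].
  have := lB xB1; rewrite in_link => /andP[_ /(fsubsetP GX)].
  by rewrite in_subsets_le fsubUset => /andP[/andP[]].
have coA : B = (X `\ x) `\` A.
  apply/fsetP => t; rewrite !inE; apply/idP/and3P => [tB|[tA tx tX]].
    split; [by apply/negP => /AB; apply| |exact: fsubsetP BX _ tB].
    by apply: contraNneq xB => <-.
  have := fsubsetP XAB _ tX; rewrite in_fsetU.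
  by move=> /orP[/(fsubsetP A1A)|/(fsubsetP B1B)]; rewrite !inE (negPf tx) ?(negPf tA).
by rewrite in_matched -coA lA ?lB.
Qed.

(** A matched [A] is disjoint from its complement, which with [x] added belongs
    to [G]; so [A] itself is not in [F], and symmetrically below.  Adding a
    matched set to the deletion therefore increases its size by one. *)
Lemma matched_notin_deletion x X F G A : crossing F G ->
  A \in matched x X F G -> A \notin deletion x F.
Proof.
move=> FG; rewrite in_matched !in_link in_deletion => /and3P[/andP[xA _] _ BG].
rewrite xA andbT; apply/negP => AF; have /fset0Pn[y] := FG _ _ AF BG.
rewrite !inE => /andP[yA]; rewrite yA /= orbF => /eqP yx.
by rewrite -yx yA in xA.
Qed.

Lemma matched_compl_notin_deletion x X F G A : crossing F G ->
  A \in matched x X F G -> (X `\ x) `\` A \notin deletion x G.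
Proof.
move=> FG; rewrite in_matched !in_link in_deletion => /andP[/andP[_ AF] _].
apply/negP => /andP[BG _]; have /fset0Pn[y] := FG _ _ AF BG.
by rewrite !inE => /andP[/orP[/eqP->|->]]; rewrite ?eqxx ?andbF.
Qed.

Lemma exists_subfset (M : {fset {fset nat}}) z : z <= #|` M| ->
  exists2 Z, Z `<=` M & #|` Z| = z.
Proof.
elim: z => [|z IHz] zM; first by exists fset0; rewrite ?fsub0set ?cardfs0.
have [Z ZM cZ] := IHz (ltnW zM).
have /fset0Pn[A] : M `\` Z != fset0 by rewrite -cardfs_gt0 cardfsDS // cZ subn_gt0.
rewrite in_fsetD => /andP[AZ AM].
by exists (A |` Z); rewrite ?cardfsU1 ?AZ ?cZ // fsubUset fsub1set AM.
Qed.

Lemma card_disjointU (S H : {fset {fset nat}}) :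
  (forall A, A \in S -> A \notin H) -> #|` H `|` S| = #|` H| + #|` S|.
Proof.
move=> SH; rewrite cardfsU; suff -> : H `&` S = fset0 by rewrite cardfs0 subn0.
apply/fsetP => A; rewrite in_fsetI in_fset0; apply/negP => /andP[AH /SH].
by rewrite AH.
Qed.

(** The [z] matched pairs of [Z] lose their partner in the link of [G], while
    their set is added to the deletion of [F]; the other [w] pairs are treated
    the other way round.  What is left of the traces contains no matched pair,
    so everything crosses.  Sizes are stated additively because subtraction is
    truncated. *)
Lemma swap_matched x X r s F G z w :
  F `<=` subsets_le X r.+1 -> G `<=` subsets_le X s.+1 ->
  crossing F G -> tight x X F G -> z + w = #|` matched x X F G| ->
  exists P Q U V,
  [/\ [/\ P `<=` subsets_le (X `\ x) r, Q `<=` subsets_le (X `\ x) r.+1,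
          U `<=` subsets_le (X `\ x) s & V `<=` subsets_le (X `\ x) s.+1],
      crossing (P `|` Q) (U `|` V),
      #|` P| + w = #|` link x F| /\ #|` Q| = #|` deletion x F| + z &
      #|` U| + z = #|` link x G| /\ #|` V| = #|` deletion x G| + w].
Proof.
move=> FX GX FG T; set M := matched x X F G => zw.
have zM : z <= #|` M| by rewrite -zw leq_addr.
have [Z ZM cZ] := exists_subfset M z zM.
pose co (A : {fset nat}) := (X `\ x) `\` A.
have lF := link_subsets_le x X r F FX; have lG := link_subsets_le x X s G GX.
have dF := deletion_subsets_le x X _ F FX; have dG := deletion_subsets_le x X _ G GX.
have MF A : A \in M -> A \in link x F by rewrite in_matched => /andP[].
have MG A : A \in M -> co A \in link x G by rewrite in_matched => /andP[].
have nF A : A \in M -> A \notin deletion x F by apply: matched_notin_deletion.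
have nG A : A \in M -> co A \notin deletion x G by apply: matched_compl_notin_deletion.
have coK A : A \in M -> co (co A) = A.
  by move=> /MF/(fsubsetP lF); rewrite in_subsets_le => /andP[/fsetDK ].
pose W := M `\` Z; pose cZs := [fset co A | A in Z]; pose cWs := [fset co A | A in W].
have WM : W `<=` M by apply: fsubsetDl.
have card_co (S : {fset {fset nat}}) : S `<=` M -> #|` [fset co A | A in S]| = #|` S|.
  move=> SM; apply: card_in_imfset => A B /(fsubsetP SM) AM /(fsubsetP SM) BM eAB.
  by rewrite -(coK A) // eAB coK.
have cW : #|` W| = w by rewrite /W cardfsDS // cZ -zw addKn.
have inZs B : B \in cZs -> exists2 A, A \in Z & B = co A.
  by case/imfsetP => A /= AZ ->; exists A.
have inWs B : B \in cWs -> exists2 A, A \in W & B = co A.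
  by case/imfsetP => A /= AZ ->; exists A.
have PQ A : A \in (link x F `\` W) `|` (deletion x F `|` Z) ->
    A \in trace x F /\ A \notin W.
  rewrite 2!in_fsetU in_fsetD [A \in trace _ _]in_fsetU.
  case/or3P => [/andP[-> ->]//|AD|AZ]; last first.
    by have AM := fsubsetP ZM _ AZ; rewrite in_fsetD AZ MF.
  rewrite AD orbT; split=> //; apply/negP => /(fsubsetP WM)/nF.
  by rewrite AD.
have UV B : B \in (link x G `\` cZs) `|` (deletion x G `|` cWs) ->
    B \in trace x G /\ B \notin cZs.
  rewrite 2!in_fsetU in_fsetD [B \in trace _ _]in_fsetU.
  case/or3P => [/andP[-> ->]//|BD|/inWs[A AW ->]]; last first.
    have AM := fsubsetP WM _ AW.
    rewrite MG //; split=> //; apply/negP => /inZs[A' AZ'].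
    move=> /(congr1 co); rewrite (coK _ AM) (coK _ (fsubsetP ZM _ AZ')) => AA'.
    by move: AW; rewrite in_fsetD AA' AZ'.
  rewrite BD orbT; split=> //; apply/negP => /inZs[A AZ eB].
  by have := nG _ (fsubsetP ZM _ AZ); rewrite -eB BD.
exists (link x F `\` W), (deletion x F `|` Z), (link x G `\` cZs), (deletion x G `|` cWs).
have WF : W `<=` link x F by apply/fsubsetP => A /(fsubsetP WM)/MF.
have ZG : cZs `<=` link x G.
  by apply/fsubsetP => B /inZs[A /(fsubsetP ZM)/MG AG ->].
split.
- split.
  + exact: fsubset_trans (fsubsetDl _ _) lF.
  + rewrite fsubUset dF; apply: fsubset_trans (subsets_leS _ _ _ (leqnSn r)).
    by apply/fsubsetP => A /(fsubsetP ZM)/MF/(fsubsetP lF).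
  + exact: fsubset_trans (fsubsetDl _ _) lG.
  + rewrite fsubUset dG; apply: fsubset_trans (subsets_leS _ _ _ (leqnSn s)).
    by apply/fsubsetP => B /inWs[A /(fsubsetP WM)/MG/(fsubsetP lG) AG ->].
- move=> A B /PQ[AF AW] /UV[BG BZ]; apply/eqP => AB0.
  have [AM eB] := tight_disjoint_traces _ _ _ _ _ _ _ GX FG T AF BG AB0.
  move: AW; rewrite in_fsetD AM andbT negbK => AZ.
  by case/negP: BZ; rewrite eB; apply: in_imfset.
- split; first by rewrite cardfsDS // cW subnK // -cW fsubset_leq_card.
  by rewrite card_disjointU ?cZ // => A /(fsubsetP ZM)/nF.
- split; first by rewrite cardfsDS // card_co // cZ subnK // -cZ -card_co // fsubset_leq_card.
  by rewrite card_disjointU ?card_co ?cW // => B /inWs[A /(fsubsetP WM)/nG AG ->].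
Qed.

(** * The bound for two families *)

(** Here [p], [q], [u], [v] are the sizes of the four families with one matched
    pair left aside; that pair counts once for each of the two families in the
    conclusion, and the two groups of hypotheses come from its two treatments.
    Summing each group shows that failure of the conclusion makes all eight
    inequalities equalities; then [p = q = u = v], so [S1 = S0], [T1 = T0], and
    [q * q.+1 = S0 * S0], which is impossible between [q * q] and
    [q.+1 * q.+1]. *)
Lemma rounded_products p q u v S1 S0 T1 T0 :
  0 < S0 -> 0 < T0 -> (S1 = S0 -> T1 = T0 -> S0 = T0) ->
  [/\ p * u.+1 <= S1 * T1, p * v.+1 <= S1 * T0,
      q * u.+1 <= S0 * T1 & q * v.+1 <= S0 * T0] ->
  [/\ p.+1 * u <= S1 * T1, p.+1 * v <= S1 * T0,
      q.+1 * u <= S0 * T1 & q.+1 * v <= S0 * T0] ->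
  (p + q).+1 * (u + v).+1 <= (S1 + S0) * (T1 + T0).
Proof.
move=> S0gt0 T0gt0 ST h k; rewrite leqNgt; apply/negP => lt.
have [pv qu qv [e2 e3 e4]] : [/\ p = v, q = u, q = v &
    [/\ p * v + p = S1 * T0, q * u + q = S0 * T1 & q * v + q = S0 * T0]].
  (* the monomials are abstracted to make the claim linear *)
  move: lt h k => {ST S0gt0 T0gt0}.
  rewrite !mulnDl !mulnDr !mulSn !mulnS !mulnDl !mulnDr.
  move: (p * u) (p * v) (q * u) (q * v) (S1 * T1) (S1 * T0) (S0 * T1) (S0 * T0).
  by move=> pu pv qu qv a b c d lt [? ? ? ?] [? ? ? ?]; do ?split; lia.
have S10 : S1 = S0 by apply/eqP; rewrite -(eqn_pmul2r T0gt0) -e2 -e4 pv qv.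
have T10 : T1 = T0 by apply/eqP; rewrite -(eqn_pmul2l S0gt0) -e3 -e4 -qu qv.
move: e4; rewrite -(ST S10 T10) -qv -mulnSr => qS.
have [leSq|ltqS] := leqP S0 q.
  by have := leq_mul leSq leSq; rewrite -qS mulnS; lia.
by have := leq_mul ltqS ltqS; rewrite -qS mulSn; lia.
Qed.

(** Allowing [r] and [s] to exceed the sizes of the ground sets lets the
    induction remove an element of the ground set while keeping [r] and [s]. *)
Lemma card_mul_crossing_le X Y r s F G :
  X != fset0 -> X `<=` Y ->
  F `<=` subsets_le X r -> G `<=` subsets_le Y s -> crossing F G ->
  #|` F| * #|` G| <= star_size #|` X| r * star_size #|` Y| s.
Proof.
move: {2}#|` Y| (erefl #|` Y|) => n.
elim: n X Y r s F G => [|n IHn] X Y r s F G cardY X0 XY FX GY FG.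
  by move: XY X0; rewrite (cardfs0_eq cardY) fsubset0 => ->.
case: s GY => [|s] GY; first by rewrite (crossing_subsets_le0 _ _ _ GY FG).
case: r FX => [|r] FX.
  by rewrite mulnC (crossing_subsets_le0 _ _ _ FX (crossing_sym _ _ FG)).
have Y_D1 y : y \in Y -> #|` Y `\ y| = n.
  by move=> yY; have := cardfsD1 y Y; rewrite yY cardY add1n => -[].
have [eXY|nXY] := eqVneq X Y; last first.
  have /fset0Pn[y] : Y `\` X != fset0.
    by rewrite fsetD_eq0; apply: contraNN nXY => YX; rewrite eqEfsubset XY.
  rewrite in_fsetD => /andP[yX yY].
  have XY1 : X `<=` Y `\ y by rewrite fsubsetD1 XY yX.
  have cardY1 := Y_D1 y yY.
  have := fsubset_leq_card XY1; rewrite cardY1 => leXn.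
  case: n => [|n] in IHn cardY Y_D1 cardY1 leXn *.
    by move: X0; rewrite -cardfs_gt0; lia.
  rewrite cardY (card_link_deletion y G) star_size_pascal !mulnDr -cardY1.
  apply: leq_add; apply: IHn => //.
  - exact: link_subsets_le.
  - exact: (crossing_link y X r.+1).
  - exact: deletion_subsets_le.
  - by move=> A B AF; rewrite in_deletion => /andP[BG _]; apply: FG.
subst Y; rewrite cardY.
have /fset0Pn[x xX] := X0.
have cardX1 := Y_D1 x xX.
case: n => [|n] in IHn cardY Y_D1 cardX1 *.
  rewrite !star_size1.
  exact: (card_mul_crossing_singleton X r.+1 s.+1).
have [F' [G' [{}FX {}GY {}FG T [<- <-]]]] := exists_tight x _ _ X _ _ FX GY FG.
move: F' G' FX GY FG T => {}F {}G FX GX FG T.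
pose M := matched x X F G.
have X10 : X `\ x != fset0 by rewrite -cardfs_gt0 cardX1.
(* the four inductive bounds after treating [z] matched pairs one way and [w]
   the other way *)
have key z w : z + w = #|` M| ->
  [/\ w <= #|` link x F|, z <= #|` link x G| &
  [/\ (#|` link x F| - w) * (#|` link x G| - z) <= star_size n.+1 r * star_size n.+1 s,
      (#|` link x F| - w) * (#|` deletion x G| + w) <= star_size n.+1 r * star_size n.+1 s.+1,
      (#|` deletion x F| + z) * (#|` link x G| - z) <= star_size n.+1 r.+1 * star_size n.+1 s &
      (#|` deletion x F| + z) * (#|` deletion x G| + w)
        <= star_size n.+1 r.+1 * star_size n.+1 s.+1]].
  move=> zw.
  have [P [Q [U [V [[PX QX UX VX] C [cP cQ] [cU cV]]]]]] :=
    swap_matched _ _ _ _ _ _ _ _ FX GX FG T zw.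
  rewrite -cP -cQ -cU -cV !addnK !leq_addl -cardX1; split=> //.
  by split; apply: IHn => // A B AP BU; apply: C; rewrite in_fsetU ?AP ?BU ?orbT.
rewrite (card_link_deletion x F) (card_link_deletion x G) !star_size_pascal.
pose h := #|` M|./2; have hM : odd #|` M| + (h + h) = #|` M| by rewrite addnn odd_double_half.
case: (odd _) hM => hM.
  (* [h] pairs are treated each way, and the remaining one in both ways in turn *)
  have [|wF zG b1] := key h h.+1; first by lia.
  have [|wF' zG' b2] := key h.+1 h; first by lia.
  have := rounded_products (#|` link x F| - h.+1) (#|` deletion x F| + h)
    (#|` link x G| - h.+1) (#|` deletion x G| + h) _ _ _ _
    (star_size_gt0 n.+1 r) (star_size_gt0 n.+1 s).
  have -> : (#|` link x F| - h.+1 + (#|` deletion x F| + h)).+1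
    = #|` link x F| + #|` deletion x F| by lia.
  have -> : (#|` link x G| - h.+1 + (#|` deletion x G| + h)).+1
    = #|` link x G| + #|` deletion x G| by lia.
  rewrite -!addnS !subnSK //.
  move=> bound; apply: bound => // /star_size_stalled nr /star_size_stalled ns.
  by apply: star_size_saturated; lia.
have [wF zG [b1 b2 b3 b4]] := key h h hM.
have -> : #|` link x F| + #|` deletion x F|
  = #|` link x F| - h + (#|` deletion x F| + h) by lia.
have -> : #|` link x G| + #|` deletion x G|
  = #|` link x G| - h + (#|` deletion x G| + h) by lia.
by lia.
Qed.

(** * From pairs to several families *)

Lemma prod_le_of_pairs k (a b : 'I_k -> nat) : 2 <= k ->
  (forall i j, i != j -> a i * a j <= b i * b j) ->
  \prod_(i < k) a i <= \prod_(i < k) b i.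
Proof.
move=> k2 ab.
have [/existsP[i bi]|/existsPn le] := boolP [exists i, b i < a i]; last first.
  by apply: leq_prod => i _; rewrite leqNgt le.
have others j : j != i -> a j <= b j.
  by move=> /ab abj; rewrite leqNgt; apply/negP => bj; have := ltn_mul bj bi; lia.
have [j ji] : exists j : 'I_k, j != i.
  apply/existsP; rewrite -negb_forall; apply/negP => /forallP all_i.
  have := all_i (Ordinal (ltnW k2)); rewrite -(eqP (all_i (Ordinal k2))).
  by rewrite -val_eqE.
rewrite (bigD1 i) // (bigD1 j) //= mulnA [leqRHS](bigD1 i) // (bigD1 j) //= [leqRHS]mulnA.
apply: leq_mul; first by apply: ab; rewrite eq_sym.
by apply: leq_prod => l /andP[li _]; apply: others.
Qed.

Theorem theorem1p2 (k : nat) (hk : 2 <= k) (n r : 'I_k -> nat)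
    (hn : forall i : 'I_k, 1 <= n i)
    (hr : forall i : 'I_k, 1 <= r i <= n i)
    (F : 'I_k -> {fset {fset nat}})
    (hF : forall i : 'I_k, F i `<=` subsets_le (segment (n i)) (r i))
    (hcross : cross_intersecting k F) :
  \prod_(i < k) #|` F i|
    <= \prod_(i < k) \sum_(1 <= j < (r i).+1) 'C(n i - 1, j - 1)
  /\ ((forall i : 'I_k, F i = star (n i) (r i)) ->
      \prod_(i < k) #|` F i|
        = \prod_(i < k) \sum_(1 <= j < (r i).+1) 'C(n i - 1, j - 1)).
Proof.
split; last first.
  by move=> FE; apply: eq_bigr => i _; rewrite FE card_star // star_sizeE.
under [leqRHS]eq_bigr => i _ do rewrite star_sizeE.
apply: prod_le_of_pairs => // i j ij.
wlog le_n : i j ij / n i <= n j => [sym|].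
  have [|/ltnW] := leqP (n i) (n j); first exact: sym.
  by move=> ?; rewrite mulnC [leqRHS]mulnC; apply: sym; rewrite // eq_sym.
rewrite -{1}(card_segment (n i)) -{1}(card_segment (n j)).
apply: card_mul_crossing_le => //.
- by apply/fset0Pn; exists 1; apply: in_segment1.
- apply/fsubsetP => t; rewrite !in_segment => /andP[-> ti].
  exact: leq_trans le_n.
- exact: hcross.
Qed.
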